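(* Let $\mathfrak{g}$ be a nilpotent Lie algebra over a finite field $\mathbb{F}$, and let $n,k$ be integers with $n\le k+1$. Suppose that (1) the set $\{x\in\mathfrak{g}: b(x)\ge n\}$ is contained in the union of $|\mathbb{F}|$ proper Lie subalgebras of $\mathfrak{g}$; and (2) the set $\{x\in\mathfrak{g}: b(x)\le k\}$ generates $\mathfrak{g}$ as a Lie algebra. Then $\dim[\mathfrak{g},\mathfrak{g}]\le \frac{(n-1)(n-2)}{2}+k$.
   Context: For an element $x$ of a Lie algebra $\mathfrak{g}$ over a field, the centralizer is $C_{\mathfrak{g}}(x)=\{y\in\mathfrak{g} : [x,y]=0\}$, and the breadth of $x$ is $b(x)=\dim\mathfrak{g}-\dim C_{\mathfrak{g}}(x)$, i.e. the codimension of $C_{\mathfrak{g}}(x)$ in $\mathfrak{g}$ (a non-negative integer or $\infty$). $[\mathfrak{g},\mathfrak{g}]$ denotes the derived subalgebra. *)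

(* Defs.v *)
From HB Require Import structures.
From mathcomp Require Import all_boot all_order all_algebra.
Set Implicit Arguments. Unset Strict Implicit. Unset Printing Implicit Defensive.
Import Order.TTheory GRing.Theory Num.Theory.
Local Open Scope ring_scope.

Section LieDefs.
Variables (F : fieldType) (L : lmodType F) (br : L -> L -> L).

Definition lie_algebra : Prop :=
  [/\ (forall (a : F) x y z, br (a *: x + y) z = a *: br x z + br y z),
      (forall (a : F) x y z, br z (a *: x + y) = a *: br z x + br z y),
      (forall x, br x x = 0) &
      (forall x y z, br x (br y z) + br y (br z x) + br z (br x y) = 0)].

Definition subalgebra (H : L -> Prop) : Prop :=
  [/\ H 0, (forall x y, H x -> H y -> H (x + y)),
      (forall (a : F) x, H x -> H (a *: x)) &
      (forall x y, H x -> H y -> H (br x y))].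

Definition proper_subalgebra (H : L -> Prop) : Prop :=
  subalgebra H /\ exists x, ~ H x.

Definition generates (S : L -> Prop) : Prop :=
  forall H, subalgebra H -> (forall x, S x -> H x) -> forall y, H y.

Fixpoint lcs (i : nat) : L -> Prop :=
  match i with
  | 0%N => fun _ => True
  | i'.+1 => fun z => exists (N : nat) (u v : 'I_N -> L),
               (forall j, lcs i' (v j)) /\ z = \sum_(j < N) br (u j) (v j)
  end.

Definition nilpotent : Prop := exists c : nat, forall z, lcs c z -> z = 0.

Definition derived : L -> Prop := lcs 1.

Definition centralizer (x : L) : L -> Prop := fun y => br x y = 0.

Definition lin_indep_mod (C : L -> Prop) (N : nat) (v : 'I_N -> L) : Prop :=
  forall c : 'I_N -> F, C (\sum_(i < N) c i *: v i) -> forall i, c i = 0.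

Definition codim_ge (C : L -> Prop) (N : nat) : Prop :=
  exists v : 'I_N -> L, lin_indep_mod C v.

(* b(x) >= n, for an integer n  (b(x) in nat ∪ {∞}) *)
Definition breadth_ge (x : L) (n : int) : Prop :=
  exists N : nat, n <= N%:Z /\ codim_ge (centralizer x) N.

Definition breadth_le (x : L) (k : int) : Prop := ~ breadth_ge x (k + 1).

Definition dim_le (S : L -> Prop) (m : int) : Prop :=
  forall N : nat, m < N%:Z ->
    ~ exists v : 'I_N -> L, (forall i, S (v i)) /\ lin_indep_mod (fun z => z = 0) v.

End LieDefs.

(* Main.v *)
(** A proper subalgebra [H] of a nilpotent [L] satisfies [H + L' <> L], and
    [{b <= k}] contains the complement of the union of the [H_a + L'], which is
    invariant under [L']; so both hypotheses become linear, and the theorem is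
    one about an alternating bilinear map [B] with [rank B(x, .) <= m = n - 1]
    off [q = |F|] proper subspaces.

    Killing [[y, L]] costs at most [m] dimensions and lowers the rank of every
    [x] not commuting with [y].  If fewer than [q] subspaces are excluded, each
    line [x + F y] with [y] outside them meets their complement, so the bad set
    for [m - 1] is the single proper subspace [C(y)], and induction gives
    [m (m + 1) / 2].  For [q] subspaces, enlarge them to hyperplanes [f_i = 0]
    with [f_i(y) = 1]; the lines that can fail are those on which the [f_i] take
    every value.  If some point [g] of the affine line through [f_0] and [f_1] is
    not an [f_i], these lie in the union of the [f_i = g], [i <> 0, 1], which
    again leaves fewer than [q] subspaces.  Otherwise the hyperplanes are a
    pencil without its member [K = (f_0 = f_1)], and an [a] outside [K] of rank
    at most [k] is used. *)
Require Import Defs.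
From HB Require Import structures.
From mathcomp Require Import all_boot all_order all_algebra.
From mathcomp Require Import boolp classical_sets ring.
Import Order.TTheory GRing.Theory Num.Theory.
Local Open Scope ring_scope.

Set Implicit Arguments.
Unset Strict Implicit.
Unset Printing Implicit Defensive.

(** * Subspaces as predicates and Steinitz exchange modulo a subspace *)

Section Subspaces.
Variables (F : fieldType) (V : lmodType F).
Implicit Types (P Q : V -> Prop) (s : seq V).

Definition subspace P := P 0 /\ forall (c : F) u v, P u -> P v -> P (c *: u + v).

Definition proper_subspace P := subspace P /\ exists x, ~ P x.

Lemma subspaceD P u v : subspace P -> P u -> P v -> P (u + v).
Proof. by case=> _ h Pu Pv; have := h 1 u v Pu Pv; rewrite scale1r. Qed.

Lemma subspaceZ P c u : subspace P -> P u -> P (c *: u).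
Proof. by case=> P0 h Pu; have := h c u 0 Pu P0; rewrite addr0. Qed.

Lemma subspaceN P u : subspace P -> P u -> P (- u).
Proof. by move=> hP Pu; rewrite -scaleN1r; apply: subspaceZ. Qed.

Lemma subspaceB P u v : subspace P -> P u -> P v -> P (u - v).
Proof. by move=> hP Pu Pv; apply: subspaceD => //; apply: subspaceN. Qed.

Lemma subspace_addl P u v : subspace P -> P u -> P (u + v) -> P v.
Proof.
by move=> hP Pu Puv; rewrite -(addKr u v) addrC; apply: subspaceB.
Qed.

Lemma subspace_sum P (I : Type) (r : seq I) (G : I -> V) :
  subspace P -> (forall i, P (G i)) -> P (\sum_(i <- r) G i).
Proof.
move=> hP PG; elim/big_ind: _ => //; first by case: hP.
by move=> u v; apply: subspaceD.
Qed.

(** The sum of [Q] and the span of [s]. Quotients are handled through the subspace killed, and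
    dimensions through lengths of lists. *)
Definition addspan Q s : V -> Prop :=
  foldr (fun w (P : V -> Prop) z => exists c : F, P (z - c *: w)) Q s.

Lemma subspace_addspan Q s : subspace Q -> subspace (addspan Q s).
Proof.
move=> hQ; elim: s => //= w s hs; split.
  by exists 0; rewrite scale0r subr0; case: hs.
move=> c u v [a ha] [b hb]; exists (c * a + b).
rewrite scalerDl opprD -scalerA addrACA -scalerBr.
by case: hs => _; apply.
Qed.

Lemma addspan_sub Q s z : Q z -> addspan Q s z.
Proof. by move=> Qz; elim: s => //= w s hs; exists 0; rewrite scale0r subr0. Qed.

Lemma addspan_mono Q Q1 s z :
  (forall z, Q z -> Q1 z) -> addspan Q s z -> addspan Q1 s z.
Proof.
by move=> sQ; elim: s z => [|w s IHs] z /=; [apply: sQ | case=> c /IHs; exists c].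
Qed.

Lemma addspan_cat Q s t : addspan Q (s ++ t) = addspan (addspan Q t) s.
Proof. exact: foldr_cat. Qed.

Lemma mem_addspan Q s z : subspace Q -> z \in s -> addspan Q s z.
Proof.
move=> hQ; elim: s => //= w s IHs; rewrite inE => /predU1P[->|/IHs h].
  by exists 1; rewrite scale1r subrr; case: (subspace_addspan s hQ).
by exists 0; rewrite scale0r subr0.
Qed.

(** Steinitz exchange: the first vector of [s] with nonzero coefficient in [z] becomes redundant
    once [z] is killed. *)
Lemma addspan_exchange Q Q1 s z :
    subspace Q -> subspace Q1 -> (forall w, Q w -> Q1 w) ->
    addspan Q s z -> ~ Q z -> Q1 z ->
  exists2 s', (size s' < size s)%N &
    forall w, addspan Q s w -> addspan Q1 s' w.
Proof.
move=> hQ hQ1 sQ + nQz Qz; elim: s => //= w s IHs [c hc].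
have [c0|c0] := eqVneq c 0.
  have [|s' lts hs] := IHs; first by move: hc; rewrite c0 scale0r subr0.
  by exists (w :: s') => // v [d /hs]; exists d.
exists s => // v [d hd].
have hsp := subspace_addspan s hQ1.
have hw : addspan Q1 s w.
  have -> : w = c^-1 *: (z - (z - c *: w)).
    by rewrite opprB addrC subrK scalerA mulVf // scale1r.
  apply: (subspaceZ _ hsp); apply: (subspaceB hsp).
    exact: addspan_sub.
  exact: addspan_mono hc.
rewrite -(subrK (d *: w) v); apply: (subspaceD hsp).
  exact: addspan_mono hd.
exact: (subspaceZ _ hsp).
Qed.

Lemma indep_leq_addspan N (v : 'I_N -> V) Q s :
    subspace Q -> lin_indep_mod Q v -> (forall i, addspan Q s (v i)) ->
  (N <= size s)%N.
Proof.
elim: N => // N IHN in v Q s * => hQ hv hs.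
pose Q1 := addspan Q [:: v ord0].
have nQ0 : ~ Q (v ord0).
  move=> Q0; have := hv (fun i => (i == ord0)%:R).
  rewrite big_ord_recl big1 => [|i _]; last by rewrite scale0r.
  by rewrite eqxx scale1r addr0 => /(_ Q0 ord0)/eqP; rewrite eqxx oner_eq0.
have [|w||s' lts hs'] := addspan_exchange hQ _ _ (hs ord0) nQ0 (Q1 := Q1).
- exact: subspace_addspan.
- exact: addspan_sub.
- by apply: mem_addspan; rewrite ?inE.
apply: leq_ltn_trans lts; apply: (IHN (v \o lift ord0) Q1).
- exact: subspace_addspan.
(* A relation modulo [Q1] is a relation modulo [Q] with coefficient [- d] on the first vector. *)
- move=> c [d] hd i; have := hv (fun j => oapp c (- d) (unlift ord0 j)).
  rewrite big_ord_recl unlift_none /= scaleNr addrC.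
  under eq_bigr => j _ do rewrite liftK /=.
  by move=> /(_ hd (lift ord0 i)); rewrite liftK.
- by move=> i; apply/hs'/hs.
Qed.

End Subspaces.

(** * Lines and unions of proper subspaces over a finite field *)

Section Covering.
Variables (F : finFieldType) (V : lmodType F) (I : eqType).
Variables (M : I -> V -> Prop).

(** Two points of the line in [M i] would put [y] in [M i], so each [M i] excludes at most one
    parameter. *)
Lemma line_avoids (s : seq I) (x y : V) :
    (size s < #|F|)%N -> {in s, forall i, subspace (M i)} ->
    {in s, forall i, ~ M i y} ->
  exists c : F, {in s, forall i, ~ M i (x + c *: y)}.
Proof.
move=> lts hM hy.
have /choice[d hd] : forall i, exists c : F,
    i \in s -> forall c', M i (x + c' *: y) -> c' = c.
  move=> i; have [[c Mc]|nM] := pselect (exists c, M i (x + c *: y)); last first.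
    by exists 0 => _ c' Mc'; case: nM; exists c'.
  exists c => si c' Mc'; apply: contrapT => /eqP; rewrite -subr_eq0 => cc'.
  case: (hy i si); rewrite -[y](scalerK cc').
  apply: subspaceZ; first exact: hM.
  have -> : (c' - c) *: y = (x + c' *: y) - (x + c *: y).
    by rewrite opprD addrACA subrr add0r scalerBl.
  by apply: subspaceB => //; apply: hM.
apply: contrapT => nc; move: lts; apply/negP; rewrite -leqNgt -(size_map d) cardE.
apply: uniq_leq_size (enum_uniq F) _ => c _; apply: contrapT => cd; apply: nc.
exists c => i si Mc; apply: cd; apply/mapP; exists i => //.
exact: (hd i si).
Qed.

(** If the vector [y] found for the tail lies in [M i], start from [x] outside [M i] and move along
    [y]: this never enters [M i], and [line_avoids] handles the tail. *)
Lemma not_covered (s : seq I) :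
    (size s <= #|F|)%N -> {in s, forall i, proper_subspace (M i)} ->
  exists y, {in s, forall i, ~ M i y}.
Proof.
elim: s => [|i s IHs] les hM; first by exists 0.
have hs : {in s, forall i, proper_subspace (M i)}.
  by move=> j sj; apply: hM; rewrite inE sj orbT.
have [y hy] := IHs (ltnW les) hs.
have [Miy|nMiy] := pselect (M i y); last first.
  by exists y => j; rewrite inE => /predU1P[->|/hy].
have [hMi [x nMix]] := hM i (mem_head _ _).
have [|c hc] := line_avoids x les _ hy; first by move=> j /hs[].
exists (x + c *: y) => j; rewrite inE => /predU1P[->|/hc //].
move=> Mixy; apply: nMix; rewrite -(addrK (c *: y) x).
by apply: subspaceB => //; apply: subspaceZ.
Qed.

End Covering.

(** * Separating a vector from a subspace by a linear form *)

Section Functional.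
Variables (F : fieldType) (V : lmodType F).
Local Open Scope classical_set_scope.

(** A subspace containing [P] and maximal for missing [y] is a hyperplane; [f] is the coordinate
    along [y]. *)
Lemma separating_functional (P : V -> Prop) (y : V) : subspace P -> ~ P y ->
  exists f : V -> F, [/\ forall c u v, f (c *: u + v) = c * f u + f v,
    f y = 1 & forall x, P x -> f x = 0].
Proof.
move=> hP nPy.
(* Uniting with [P] makes the empty union of the empty chain admissible. *)
pose T (A : set V) := subspace (A `|` P) /\ ~ (A `|` P) y.
have [C sC Ctot|A [[hA nAy] maxA]] := @Zorn_bigcup V T.
  split; last by case=> // -[X CX Xy]; case: (sC X CX) => _; apply; left.
  split; first by right; case: hP.
  have dom u v : (\bigcup_(X in C) X `|` P) u -> (\bigcup_(X in C) X `|` P) v ->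
      (P u /\ P v) \/ exists2 X, C X & (X `|` P) u /\ (X `|` P) v.
    move=> [[X CX Xu]|Pu] [[Y CY Yv]|Pv]; last by left.
    - right; have [XY|YX] := Ctot X Y CX CY.
        by exists Y => //; split; left => //; apply: XY.
      by exists X => //; split; left => //; apply: YX.
    - by right; exists X => //; split; [left|right].
    - by right; exists Y => //; split; [right|left].
  move=> c u v /dom h /h [[Pu Pv]|[X CX [Xu Xv]]].
    by right; case: hP => _; apply.
  have [[_ hX] _] := sC X CX.
  by case: (hX c u v Xu Xv) => [h'|]; [left; exists X|right].
pose M := A `|` P.
have uniqM c d x : M (x - c *: y) -> M (x - d *: y) -> c = d.
  move=> Mc Md; apply: contrapT => /eqP; rewrite -subr_eq0 => cd.
  apply: nAy; rewrite -[y](scalerK cd); apply: (subspaceZ _ hA).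
  have -> : (c - d) *: y = (x - d *: y) - (x - c *: y).
    by rewrite opprB [RHS]addrC addrA subrK scalerBl.
  exact: subspaceB.
have /choice[f hf] : forall x, exists c : F, M (x - c *: y).
  move=> x; have [Mx|nMx] := pselect (M x); first by exists 0; rewrite scale0r subr0.
  apply: contrapT => nc.
  (* This is [M + F x]. By maximality it contains [y], and solving for [x] gives the missing
     coordinate. *)
  pose A1 : set V := fun z => exists c : F, M (z - c *: x).
  have A1P : A1 `|` P = A1.
    apply/seteqP; split=> z; last by left.
    by case=> // Pz; exists 0; rewrite scale0r subr0; right.
  apply: (maxA A1).
    split=> [z Az|sA1]; first by exists 0; rewrite scale0r subr0; left.
    by apply: nMx; left; apply: sA1; exists 1; rewrite scale1r subrr; case: hA.
  rewrite /T A1P; split; first exact: (subspace_addspan [:: x] hA).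
  case=> c Mc; have [c0|c0] := eqVneq c 0.
    by apply: nAy; move: Mc; rewrite c0 scale0r subr0.
  apply: nc; exists c^-1.
  have -> : x - c^-1 *: y = - c^-1 *: (y - c *: x).
    by rewrite scalerBr !scaleNr opprK scalerA mulVf // scale1r addrC.
  exact: (subspaceZ _ hA).
exists f; split.
- move=> c u v; apply: uniqM (hf _) _.
  rewrite scalerDl opprD -scalerA addrACA -scalerBr.
  by case: hA => _; apply; apply: hf.
- by apply: uniqM (hf _) _; rewrite scale1r subrr; case: hA.
- by move=> x Px; apply: uniqM (hf _) _; rewrite scale0r subr0; right.
Qed.

End Functional.

(** * Alternating bilinear maps and ranks modulo a subspace *)

Section AlternatingMaps.
Variables (F : fieldType) (V W : lmodType F) (B : V -> V -> W).
Hypothesis Bl : forall (c : F) x y u, B (c *: x + y) u = c *: B x u + B y u.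
Hypothesis Br : forall (c : F) x y u, B u (c *: x + y) = c *: B u x + B u y.
Hypothesis Bxx : forall x, B x x = 0.
Implicit Types (Q : W -> Prop).

Lemma bilinDl x y u : B (x + y) u = B x u + B y u.
Proof. by have := Bl 1 x y u; rewrite !scale1r. Qed.

Lemma bilinDr x y u : B u (x + y) = B u x + B u y.
Proof. by have := Br 1 x y u; rewrite !scale1r. Qed.

Lemma bilin0l u : B 0 u = 0.
Proof. by apply: (addrI (B 0 u)); rewrite -bilinDl !addr0. Qed.

Lemma bilin0r u : B u 0 = 0.
Proof. by apply: (addrI (B u 0)); rewrite -bilinDr !addr0. Qed.

Lemma bilinZl c x u : B (c *: x) u = c *: B x u.
Proof. by have := Bl c x 0 u; rewrite bilin0l !addr0. Qed.

Lemma bilinZr c x u : B u (c *: x) = c *: B u x.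
Proof. by have := Br c x 0 u; rewrite bilin0r !addr0. Qed.

Lemma bilinBr x y u : B u (x - y) = B u x - B u y.
Proof. by rewrite bilinDr -scaleN1r bilinZr scaleN1r. Qed.

Lemma alternating_opp x y : B x y = - B y x.
Proof.
apply/eqP; rewrite -addr_eq0; apply/eqP.
by have := Bxx (x + y); rewrite bilinDl !bilinDr !Bxx addr0 add0r.
Qed.

Lemma subspace_ann Q y : subspace Q -> subspace (fun x => Q (B y x)).
Proof.
by move=> hQ; split=> [|c u v Qu Qv]; rewrite ?bilin0r ?Br; case: hQ => // _; apply.
Qed.

Definition rank_le Q (x : V) (m : nat) :=
  exists2 s, (size s <= m)%N & forall u, addspan Q s (B x u).

Definition image_dim_le Q (m : nat) :=
  exists2 s, (size s <= m)%N & forall x u, addspan Q s (B x u).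

Lemma image_dim_leW Q m n :
  (m <= n)%N -> image_dim_le Q m -> image_dim_le Q n.
Proof. by move=> mn [s sm hs]; exists s => //; apply: leq_trans mn. Qed.

Lemma image_dim_le_addspan Q s m n :
  (size s <= m)%N -> image_dim_le (addspan Q s) n -> image_dim_le Q (n + m).
Proof.
move=> sm [t tn ht]; exists (t ++ s); first by rewrite size_cat leq_add.
by move=> x u; rewrite addspan_cat.
Qed.

Lemma rank_le_shift Q x y c m : subspace Q -> (forall u, Q (B y u)) ->
  rank_le Q (x + c *: y) m -> rank_le Q x m.
Proof.
move=> hQ Qy [s sm hs]; exists s => // u.
have -> : B x u = B (x + c *: y) u - c *: B y u by rewrite bilinDl bilinZl addrK.
have hs' := subspace_addspan s hQ.
apply: (subspaceB hs' (hs u)); apply: (subspaceZ _ hs').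
exact: addspan_sub.
Qed.

(* [B x y] lies in the killed space, so the rank of [x + c y] drops by one;
   modulo that space it is also the rank of [x]. *)
Lemma rank_le_quotient Q Q1 x y c m :
    subspace Q -> subspace Q1 -> (forall z, Q z -> Q1 z) ->
    (forall u, Q1 (B y u)) -> ~ Q (B y x) -> rank_le Q (x + c *: y) m.+1 ->
  rank_le Q1 x m.
Proof.
move=> hQ hQ1 sQ Qy nQyx [s sm hs]; apply: (rank_le_shift (c := c) hQ1 Qy).
have Bxy : B (x + c *: y) y = - B y x.
  by rewrite bilinDl bilinZl Bxx scaler0 addr0 alternating_opp.
have [||s' lts hs'] := addspan_exchange hQ hQ1 sQ (hs y).
- by rewrite Bxy => /(subspaceN hQ); rewrite opprK.
- by rewrite Bxy; apply: subspaceN.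
exists s'; first exact: leq_trans lts sm.
by move=> u; apply: hs'.
Qed.

Lemma noncentral_rank_gt0 Q x u m :
  ~ Q (B x u) -> rank_le Q x m -> (0 < m)%N.
Proof. by case: m => // nQ [[|//] _ /(_ u)]. Qed.

End AlternatingMaps.

(** * Dimension bounds from small rank off proper subspaces *)

Section Covered.
Variables (F : finFieldType) (V W : lmodType F) (B : V -> V -> W).
Hypothesis Bl : forall (c : F) x y u, B (c *: x + y) u = c *: B x u + B y u.
Hypothesis Br : forall (c : F) x y u, B u (c *: x + y) = c *: B u x + B u y.
Hypothesis Bxx : forall x, B x x = 0.
Implicit Types (Q : W -> Prop) (K D : V -> Prop).

Let BDl := bilinDl Bl.
Let BDr := bilinDr Br.
Let BZl := bilinZl Bl.
Let BZr := bilinZr Br.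
Let BBr := bilinBr Br.
Let Bopp := alternating_opp Bl Br Bxx.

(** The vectors off all [M i] span [V]: any [x] is [x + c *: y] minus [c *: y] with [x + c *: y] and
    [y] both avoiding. *)
Lemma image_in_avoiding Q (I : eqType) (s : seq I) (M : I -> V -> Prop) :
    subspace Q -> (size s < #|F|)%N ->
    {in s, forall i, proper_subspace (M i)} ->
    (forall x u, {in s, forall i, ~ M i x} -> Q (B x u)) ->
  forall x u, Q (B x u).
Proof.
move=> hQ lts hM hs x u; have [y My] := not_covered (ltnW lts) hM.
have [|c Mc] := line_avoids x lts _ My; first by move=> i /hM[].
rewrite -(addrK (c *: B y u) (B x u)) -BZl -BDl; apply: (subspaceB hQ).
  exact: hs.
by rewrite BZl; apply: (subspaceZ _ hQ); apply: hs.
Qed.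

Lemma image_dim_le_avoiding (m : nat) Q (I : eqType) (s : seq I)
    (M : I -> V -> Prop) :
    subspace Q -> (size s < #|F|)%N ->
    {in s, forall i, proper_subspace (M i)} ->
    (forall x, {in s, forall i, ~ M i x} -> rank_le B Q x m) ->
  image_dim_le B Q 'C(m.+1, 2).
Proof.
elim: m Q I s M => [|m IHm] Q I s M hQ lts hM rkm;
  have [[y [u [My nQyu]]]|ncent] :=
    pselect (exists y u, {in s, forall i, ~ M i y} /\ ~ Q (B y u)).
- by have := noncentral_rank_gt0 nQyu (rkm y My).
- exists [::] => //; apply: (image_in_avoiding hQ lts hM) => x u Mx.
  by apply: contrapT => nQ; apply: ncent; exists x, u.
- have [t tm ht] := rkm y My; pose Q1 := addspan Q t.
  have hQ1 : subspace Q1 by exact: subspace_addspan.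
  rewrite binS bin1; apply: (image_dim_le_addspan tm).
  (* Whatever the original list, only the centralizer of [y] modulo [Q] remains excluded. *)
  apply: (IHm Q1 unit [:: tt] (fun _ x => Q (B y x))) => //.
  + exact: card_finNzRing_gt1.
  + by move=> i _; split; [exact: (subspace_ann Br) | exists u].
  move=> x nQyx.
  have [|c Mc] := line_avoids x lts _ My; first by move=> i /hM[].
  apply: (rank_le_quotient Bl Br Bxx hQ hQ1 _ ht (nQyx tt (mem_head _ _)) (rkm _ Mc)).
  exact: addspan_sub.
- exists [::] => //; apply: (image_in_avoiding hQ lts hM) => x u Mx.
  by apply: contrapT => nQ; apply: ncent; exists x, u.
Qed.

(** The part of [K] off [D] spans [K], so [a] is central modulo [Q]. Ranks then depend only on the
    [K]-component, and the bad set is the single subspace spanned by [a] and the intersection of [K]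
    and [D]. *)
Lemma image_dim_le_pencil_central (m : nat) Q K D (a y0 : V) :
    subspace Q -> subspace K -> subspace D ->
    K y0 -> ~ D y0 -> ~ K a -> (forall x, exists c : F, K (x - c *: a)) ->
    (forall x, K x -> ~ D x -> rank_le B Q x m) ->
    (forall x, K x -> ~ D x -> Q (B a x)) ->
  image_dim_le B Q 'C(m.+1, 2).
Proof.
move=> hQ hK hD Ky0 nDy0 nKa hKa rkK Qa.
have QaK x : K x -> Q (B a x).
  move=> Kx; have [Dx|/Qa] := pselect (D x); last exact.
  apply: (subspace_addl hQ (Qa _ Ky0 nDy0)); rewrite -BDr; apply: Qa.
    exact: subspaceD.
  by rewrite addrC => /(subspace_addl hD Dx).
have Qaa x : Q (B a x).
  have [c Kc] := hKa x; rewrite -(subrK (c *: a) x) BDr BZr Bxx scaler0 addr0.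
  exact: QaK.
pose KD x := K x /\ D x; have hKD : subspace KD.
  split; first by split; [case: hK | case: hD].
  by move=> c u v [Ku Du] [Kv Dv]; split; [case: hK | case: hD] => _; apply.
apply: (@image_dim_le_avoiding m Q unit [:: tt] (fun _ => addspan KD [:: a])) => //.
- exact: card_finNzRing_gt1.
- move=> i _; split; first exact: subspace_addspan.
  exists y0; case=> c [Kc Dc]; have [c0|c0] := eqVneq c 0.
    by move: Dc; rewrite c0 scale0r subr0.
  apply: nKa; rewrite -[a](scalerK c0); apply: (subspaceZ _ hK).
  by rewrite -[c *: a](subKr y0); apply: subspaceB.
move=> x /(_ tt (mem_head _ _)) nKDx; have [c Kc] := hKa x.
apply: (rank_le_shift (y := a) (c := - c) Bl hQ) => //.
by rewrite scaleNr; apply: rkK => // Dc; apply: nKDx; exists c.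
Qed.

(** The hypotheses force [K] to be abelian modulo [Q]; as [V] is [K + F a], the values of [B a] then
    span the whole image. *)
Lemma image_dim_le_pencil_abelian (k : nat) Q K D (a y0 : V) :
    subspace Q -> subspace K -> subspace D ->
    K y0 -> ~ D y0 -> ~ Q (B a y0) -> (forall x, exists c : F, K (x - c *: a)) ->
    (forall x, K x -> ~ D x -> ~ Q (B a x) -> forall v, K v -> Q (B x v)) ->
    rank_le B Q a k ->
  image_dim_le B Q k.
Proof.
move=> hQ hK hD Ky0 nDy0 nQy0 hKa hc [s sk hs].
pose Z x := forall v, K v -> Q (B x v).
have hZ : subspace Z.
  split=> [v _|c x y Zx Zy v Kv]; first by rewrite (bilin0l Bl); case: hQ.
  by rewrite Bl; case: hQ => _; apply; [apply: Zx | apply: Zy].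
have Zy0 : Z y0 by exact: hc.
have ZDa x : K x -> D x -> Q (B a x) -> Z x.
  move=> Kx Dx Qax; apply: (subspace_addl hZ Zy0); apply: hc.
  - exact: subspaceD.
  - by rewrite addrC => /(subspace_addl hD Dx).
  - by rewrite addrC BDr => /(subspace_addl hQ Qax).
(* Off [Z], translating by [y0] moves [x] into [D] with [x + y0] centralizing
   [a]; the difference of two such translates is in [D] and centralizes [a]. *)
have nZ x : K x -> ~ Z x -> exists c : F,
    D (x + c *: y0) /\ Q (B a (x + c *: y0 + y0)).
  move=> Kx nZx; have [Dx|nDx] := pselect (D x).
    exists 0; rewrite scale0r addr0; split=> //; apply: contrapT => nQ; apply: nZx.
    apply: (subspace_addl hZ Zy0); apply: hc.
    - exact: subspaceD.
    - by rewrite addrC => /(subspace_addl hD Dx).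
    - by rewrite addrC.
  have Qax : Q (B a x) by apply: contrapT => nQ; apply: nZx; apply: hc.
  exists (- 1); rewrite scaleN1r subrK; split=> //.
  apply: contrapT => nD; apply: nZx; rewrite -(subrK y0 x).
  apply: (subspaceD hZ) => //; apply: hc => //; first exact: subspaceB.
  move=> Qa; apply: nQy0; rewrite -[y0](subKr x) BBr.
  exact: subspaceB.
have KK x y : K x -> K y -> Q (B x y).
  move=> Kx Ky; have [Zx|/nZ[//|c [Dc Qc]]] := pselect (Z x); first exact: Zx.
  have [Zy|/nZ[//|d [Dd Qd]]] := pselect (Z y).
    by rewrite Bopp; apply: (subspaceN hQ); apply: Zy.
  have Zcd : Z (x + c *: y0 - (y + d *: y0)).
    apply: ZDa; last 1 first.
    - have -> : B a (x + c *: y0 - (y + d *: y0)) =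
          B a (x + c *: y0 + y0) - B a (y + d *: y0 + y0).
        by rewrite -BBr [in RHS]opprD [in RHS]addrACA subrr addr0.
      exact: subspaceB.
    - by apply: (subspaceB hK); apply: (subspaceD hK) => //; apply: (subspaceZ _ hK).
    - exact: subspaceB.
  (* Since [y0] is in [Z], so is [x - y]; and [B x y] equals [B (x - y) y] because [B] is
     alternating. *)
  have Zxy : Z (x - y).
    rewrite -(addrK ((c - d) *: y0) (x - y)); apply: (subspaceB hZ).
      by move: Zcd; rewrite scalerBl opprD addrACA.
    exact: (subspaceZ _ hZ).
  by rewrite -(subrK y x) BDl Bxx addr0; apply: Zxy.
exists s => // x y; have [c Kc] := hKa x; have [d Kd] := hKa y.
have hs' := subspace_addspan s hQ.
rewrite -(subrK (c *: a) x) BDl BZl; apply: (subspaceD hs'); last first.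
  exact: (subspaceZ _ hs').
rewrite -(subrK (d *: a) y) BDr BZr; apply: (subspaceD hs').
  by apply: addspan_sub; apply: KK.
by apply: (subspaceZ _ hs'); rewrite Bopp; apply: (subspaceN hs').
Qed.

Lemma image_dim_le_pencil_degenerate (m k : nat) Q K D (a y0 : V) :
    subspace Q -> subspace K -> subspace D ->
    K y0 -> ~ D y0 -> ~ K a -> (forall x, exists c : F, K (x - c *: a)) ->
    (forall x, K x -> ~ D x -> rank_le B Q x m) -> rank_le B Q a k ->
    (m <= k)%N ->
    (forall x, K x -> ~ D x -> ~ Q (B a x) -> forall v, K v -> Q (B x v)) ->
  image_dim_le B Q ('C(m, 2) + k).
Proof.
move=> hQ hK hD Ky0 nDy0 nKa hKa rkK rka mk hc.
have [[y [Ky nDy nQay]]|nC] := pselect (exists y, [/\ K y, ~ D y & ~ Q (B a y)]).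
  apply: (image_dim_leW (leq_addl _ _)).
  exact: (image_dim_le_pencil_abelian hQ hK hD Ky nDy nQay hKa hc rka).
apply: (@image_dim_leW _ _ _ B _ 'C(m.+1, 2)); first by rewrite binS bin1 leq_add2l.
apply: (image_dim_le_pencil_central hQ hK hD Ky0 nDy0 nKa hKa rkK).
by move=> x Kx nDx; apply: contrapT => nQ; apply: nC; exists x.
Qed.

(** Outside the degenerate case some [y] in [K] off [D] commutes neither with [a] nor with some [v]
    in [K]. Killing the values of [B y] lowers the rank of [a] as well as those on [K], so [m] and
    [k] drop together; the centralizer of [y] replaces [D], and [v] replaces [y0]. *)
Lemma image_dim_le_pencil (m k : nat) Q K D (a y0 : V) :
    subspace Q -> subspace K -> subspace D ->
    K y0 -> ~ D y0 -> ~ K a -> (forall x, exists c : F, K (x - c *: a)) ->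
    (forall x, K x -> ~ D x -> rank_le B Q x m) -> rank_le B Q a k ->
    (m <= k)%N ->
  image_dim_le B Q ('C(m, 2) + k).
Proof.
move=> + hK + + + nKa hKa.
elim: m k Q D y0 => [|m IHm] k Q D y0 hQ hD Ky0 nDy0 rkK rka mk;
  have [hc|nhc] := pselect
    (forall x, K x -> ~ D x -> ~ Q (B a x) -> forall v, K v -> Q (B x v)).
1,3: exact: (image_dim_le_pencil_degenerate hQ hK hD Ky0 nDy0 nKa hKa rkK).
all: have [y [Ky nDy nQay [v Kv nQyv]]] : exists y,
  [/\ K y, ~ D y, ~ Q (B a y) & exists2 v, K v & ~ Q (B y v)];
  first by [apply: contrapT => nE; apply: nhc => x Kx nDx nQax v Kv;
    apply: contrapT => nQ; apply: nE; exists x; split=> //; exists v].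
  by have := noncentral_rank_gt0 nQyv (rkK y Ky nDy).
have := noncentral_rank_gt0 nQay rka.
case: k rka mk => // k rka mk _.
have [t tm ht] := rkK y Ky nDy; pose Q1 := addspan Q t.
have hQ1 : subspace Q1 by exact: subspace_addspan.
have sQ z : Q z -> Q1 z by exact: addspan_sub.
have -> : ('C(m.+1, 2) + k.+1 = 'C(m, 2) + k + m.+1)%N.
  by rewrite binS bin1 !addnS addnAC.
apply: (image_dim_le_addspan tm); rewrite -/Q1.
apply: (IHm k Q1 (fun x => Q (B y x)) v) => //.
- exact: (subspace_ann Br).
- move=> x Kx nQyx; have [Dx|nDx] := pselect (D x); last first.
    apply: (rank_le_quotient (c := 0) Bl Br Bxx hQ hQ1 sQ ht nQyx).
    by rewrite scale0r addr0; apply: rkK.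
  (* For [x] in [D], the translate [x + y] lies off [D]. *)
  apply: (rank_le_quotient (c := 1) Bl Br Bxx hQ hQ1 sQ ht nQyx).
  rewrite scale1r; apply: rkK; first exact: subspaceD.
  by move/(subspace_addl hD Dx).
- apply: (rank_le_quotient (c := 0) Bl Br Bxx hQ hQ1 sQ ht).
    by rewrite Bopp => /(subspaceN hQ); rewrite opprK.
  by rewrite scale0r addr0.
Qed.

(** If [y] is central modulo [Q], rank is constant along each line. Otherwise kill the values of
    [B y]; the centralizer of [y] joins the list as [None], whence the spare place in the size
    bound. *)
Lemma image_dim_le_line_avoiding (m : nat) Q (y : V) (I : eqType) (s : seq I)
    (M : I -> V -> Prop) :
    subspace Q -> ((size s).+1 < #|F|)%N ->
    {in s, forall i, proper_subspace (M i)} -> rank_le B Q y m ->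
    (forall x, {in s, forall i, ~ M i x} ->
      exists c : F, rank_le B Q (x + c *: y) m) ->
  image_dim_le B Q 'C(m.+1, 2).
Proof.
move=> hQ lts hM rky rkx.
have [[u nQyu]|Qy] := pselect (exists u, ~ Q (B y u)); last first.
  apply: (image_dim_le_avoiding hQ (ltnW lts) hM) => x /rkx[c].
  by apply: (rank_le_shift Bl) => // u; apply: contrapT => nQ; apply: Qy; exists u.
case: m rky rkx => [/(noncentral_rank_gt0 nQyu)//|m [t tm ht] rkx].
have hQ1 : subspace (addspan Q t) by exact: subspace_addspan.
rewrite binS bin1; apply: (image_dim_le_addspan tm).
apply: (image_dim_le_avoiding (s := None :: [seq Some i | i <- s])
  (M := fun o x => if o is Some i then M i x else Q (B y x)) hQ1).
- by rewrite /= size_map.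
- case=> [i|]; last by split; [exact: (subspace_ann Br) | exists u].
  by rewrite inE /= => /mapP[j sj [->]]; apply: hM.
move=> x Mx; have [i si|c rkc] := rkx x.
  by apply: (Mx (Some i)); rewrite inE /=; apply: map_f.
apply: (rank_le_quotient Bl Br Bxx hQ hQ1 _ ht (Mx None (mem_head _ _)) rkc).
exact: addspan_sub.
Qed.

Lemma image_dim_le_covering (m k : nat) Q (H : F -> V -> Prop) :
    subspace Q -> (forall i, proper_subspace (H i)) ->
    (forall x, (forall i, ~ H i x) -> rank_le B Q x m) -> (m <= k)%N ->
    (forall K, proper_subspace K -> exists2 a, ~ K a & rank_le B Q a k) ->
  image_dim_le B Q ('C(m, 2) + k).
Proof.
move=> hQ hH rkm mk spank.
have [|i _|y Hy] := not_covered (M := H) (s := enum F); rewrite -?cardE //.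
have {}Hy i : ~ H i y by apply: Hy; rewrite mem_enum.
have /choice[f hf] i := separating_functional (proj1 (hH i)) (Hy i).
have fl i c u v : f i (c *: u + v) = c * f i u + f i v by case: (hf i).
have fy i : f i y = 1 by case: (hf i).
have fH i x : H i x -> f i x = 0 by case: (hf i) => _ _; apply.
have rky : rank_le B Q y m by exact: rkm.
(* The affine line of forms through [f 0] and [f 1], all equal to 1 at [y]. *)
pose p s x := f 0 x + s * (f 1 x - f 0 x).
have ker_sub (g h : V -> F) : (forall c u v, g (c *: u + v) = c * g u + g v) ->
    (forall c u v, h (c *: u + v) = c * h u + h v) ->
    subspace (fun x => g x = h x).
  move=> gl hl; split; last by move=> c u v gu gv; rewrite gl hl gu gv.
  by rewrite -(subrr y) addrC -scaleN1r gl hl !mulN1r !addNr.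
(* Subtracting [v *: y] shifts every [f i x] by [- v], so a missed value [v] yields a point off all
   [H i]. *)
have rk_missed x v : (forall i, f i x <> v) -> exists c : F, rank_le B Q (x + c *: y) m.
  move=> fv; exists (- v); apply: rkm => i /fH.
  by rewrite addrC fl fy mulr1 addrC => /eqP; rewrite subr_eq0 => /eqP/fv.
(* The map sending [i] to [f i x] is a self-map of the finite set [F]; not being injective, it
   misses a value. *)
have rk_collision x : f 0 x = f 1 x -> exists c : F, rank_le B Q (x + c *: y) m.
  move=> f01; apply: contrapT => nc.
  have /choice[g gK] : forall v, exists i, f i x = v.
    move=> v; apply: contrapT => ni; apply: nc; apply: (rk_missed x v) => i fi.
    by apply: ni; exists i.
  have [g' _ gg'] := injF_bij (can_inj (g := f^~ x) gK).
  have := oner_neq0 F; rewrite -[1]gg' -[0]gg' => /eqP; apply; congr g.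
  by rewrite -[LHS]gK -[RHS]gK !gg'.
have mC : ('C(m.+1, 2) <= 'C(m, 2) + k)%N by rewrite binS bin1 leq_add2l.
have [[x0 fx0]|f01] := pselect (exists x, f 0 x <> f 1 x); last first.
  apply: (image_dim_leW mC).
  apply: (image_dim_le_line_avoiding (s := [::] : seq F) (M := H) hQ _ _ rky) => //.
    exact: card_finNzRing_gt1.
  by move=> x _; apply: rk_collision; apply: contrapT => nf; apply: f01; exists x.
have pl s c u v : p s (c *: u + v) = c * p s u + p s v by rewrite /p !fl; ring.
(* First case: [p s] is none of the [f i]. Excluding [f i = p s] for [i] other than 0 and 1 costs
   [|F| - 2] subspaces; elsewhere the value [p s x] is missed, unless [f 0] and [f 1] collide at
   [x]. *)
have [[s hs]|hp] := pselect (exists s, forall i, exists x, f i x <> p s x).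
  apply: (image_dim_leW mC).
  apply: (image_dim_le_line_avoiding (s := enum (predC (pred2 (0 : F) 1)))
    (M := fun i x => f i x = p s x) hQ _ _ rky).
  - by rewrite -cardE -(cardC (pred2 (0 : F) 1)) card2 eq_sym oner_eq0.
  - by move=> i _; split; [exact: ker_sub | exact: hs].
  move=> x nfp; have [/rk_collision//|nf01] := pselect (f 0 x = f 1 x).
  have d0 : f 1 x - f 0 x != 0 by rewrite subr_eq0 eq_sym; apply/eqP.
  apply: (rk_missed x (p s x)) => i fi.
  have [i01|ni01] := boolP (i \in pred2 (0 : F) 1); last first.
    by apply: (nfp i) => //; rewrite mem_enum.
  have si : s = i.
    apply: (mulIf d0); apply: (addrI (f 0 x)); rewrite -[LHS]fi.
    by move: i01; rewrite inE => /orP[]/eqP->; rewrite ?mul0r ?mul1r ?addr0 // addrC subrK.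
  have [z] := hs i; apply; rewrite /p si.
  by move: i01; rewrite inE => /orP[]/eqP->; rewrite ?mul0r ?mul1r ?addr0 // addrC subrK.
have /choice[i hi] : forall s, exists i, forall x, f i x = p s x.
  move=> s; apply: contrapT => ni; apply: hp; exists s => i.
  by apply: contrapT => nx; apply: ni; exists i => x; apply: contrapT => nf;
    apply: nx; exists x.
have d0 : f 1 x0 - f 0 x0 != 0 by rewrite subr_eq0 eq_sym; apply/eqP.
(* Now every [p s] is some [f i]; by counting, the [f i] are exactly the forms [p s]. *)
have iI : injective i.
  move=> s t ist; apply: (mulIf d0); apply: (addrI (f 0 x0)).
  by rewrite -[LHS](hi s) -[RHS](hi t) ist.
have [i' _ ii'] := injF_bij iI.
(* On [K] all the [f i] agree with [f 0], so within [K] only the kernel of [f 0] is excluded. *)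
pose K x := f 0 x = f 1 x; have hK : subspace K by exact: ker_sub.
have [|a nKa rka] := spank K; first by split=> //; exists x0.
have da : f 1 a - f 0 a != 0 by rewrite subr_eq0 eq_sym; apply/eqP.
apply: (image_dim_le_pencil (K := K) (D := fun x => f 0 x = 0) (a := a) (y0 := y)) => //.
- by apply: (ker_sub (f 0) (fun=> 0)) => // *; rewrite mulr0 addr0.
- by rewrite /K !fy.
- by rewrite fy; apply/eqP; apply: oner_neq0.
- move=> x; exists ((f 1 x - f 0 x) / (f 1 a - f 0 a)).
  rewrite /K -scaleNr addrC !fl.
  apply/eqP; rewrite -subr_eq0; apply/eqP; field.
  by [].
move=> x Kx nfx; apply: rkm => j /fH; rewrite -[j]ii' hi /p -Kx subrr mulr0 addr0.
exact: nfx.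
Qed.

End Covered.

(** * Lower central series, subalgebras modulo [L'], and breadth as rank *)

Section NilpotentLieAlgebras.
Variables (F : fieldType) (L : lmodType F) (br : L -> L -> L).
Hypothesis Hlie : lie_algebra br.

Lemma subspace_of_subalgebra (H : L -> Prop) : subalgebra br H -> subspace H.
Proof. by case=> H0 HD HZ _; split=> // c u v Hu Hv; apply: HD => //; apply: HZ. Qed.

Let brl : forall (c : F) x y z, br (c *: x + y) z = c *: br x z + br y z.
Proof. by case: Hlie. Qed.

Let brr : forall (c : F) x y z, br z (c *: x + y) = c *: br z x + br z y.
Proof. by case: Hlie. Qed.

Let brxx : forall x, br x x = 0.
Proof. by case: Hlie. Qed.

Lemma subspace_lcs i : subspace (lcs br i).
Proof.
case: i => [|i] //=; split.
  by exists 0%N, (fun=> 0), (fun=> 0); split=> [[]|]//; rewrite big_ord0.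
move=> c _ _ [M [u [v [hv ->]]]] [N [u' [v' [hv' ->]]]].
exists (M + N)%N,
  (fun j => match split j with inl a => c *: u a | inr b => u' b end),
  (fun j => match split j with inl a => v a | inr b => v' b end); split.
  by move=> j; case: splitP.
rewrite big_split_ord scaler_sumr; congr (_ + _); apply: eq_bigr => j _.
  by rewrite -[lshift N j]/(unsplit (inl j)) unsplitK (bilinZl brl).
by rewrite -[rshift M j]/(unsplit (inr j)) unsplitK.
Qed.

Lemma lcs_br i x y : lcs br i y -> lcs br i.+1 (br x y).
Proof.
by move=> hy; exists 1%N, (fun=> x), (fun=> y); split=> //; rewrite big_ord1.
Qed.

Definition add_derived (H : L -> Prop) (x : L) : Prop :=
  exists2 h, H h & derived br (x - h).

Lemma subspace_add_derived (H : L -> Prop) : subspace H -> subspace (add_derived H).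
Proof.
move=> hH; split.
  by exists 0; rewrite ?subrr; [case: hH | case: (subspace_lcs 1)].
move=> c u v [h Hh dh] [h' Hh' dh']; exists (c *: h + h').
  by case: hH => _; apply.
rewrite opprD addrACA -scalerBr; case: (subspace_lcs 1) => _; exact.
Qed.

Lemma add_derived_addr (H : L -> Prop) x z :
  derived br z -> add_derived H (x + z) -> add_derived H x.
Proof.
move=> dz [h Hh dh]; exists h => //.
have -> : x - h = x + z - h - z by rewrite addrAC addrK.
exact: (subspaceB (subspace_lcs 1)).
Qed.

(* [H + L' = L] propagates to [H + L^i = L] for every [i]: with [u = h + g] and
   [v = h' + g'], [[u, v]] is in [H] up to brackets having an entry in [L^i]. *)
Lemma proper_add_derived (H : L -> Prop) : nilpotent br ->
  proper_subalgebra br H -> proper_subspace (add_derived H).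
Proof.
move=> [c hc] [hH [x nHx]].
have hHs := subspace_of_subalgebra hH.
split; first exact: subspace_add_derived.
apply: contrapT => nE; apply: nHx.
have HL z : exists2 h, H h & derived br (z - h).
  by apply: contrapT => nh; apply: nE; exists z.
have Hlcs i z : exists2 h, H h & lcs br i (z - h).
  elim: i z => [|i IHi] z; first by exists 0 => //; case: hH.
  have hl := subspace_lcs i.+1.
  pose P w := exists2 h, H h & lcs br i.+1 (w - h).
  have hP : subspace P.
    split; first by exists 0; rewrite ?subrr; [case: hH | case: hl].
    move=> d u v [h Hh lh] [h' Hh' lh']; exists (d *: h + h').
      by case: hHs => _; apply.
    by rewrite opprD addrACA -scalerBr; case: hl => _; apply.
  have [h Hh [N [u [v [_ zh]]]]] := HL z.
  rewrite -[z](subrK h) zh; apply: (subspaceD hP); last first.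
    by exists h; rewrite ?subrr //; case: hl.
  apply: (subspace_sum _ hP) => j.
  have [a Ha la] := IHi (u j); have [b Hb lb] := IHi (v j).
  exists (br a b); first by case: hH => _ _ _; apply.
  have -> : br (u j) (v j) - br a b = br (u j) (v j - b) - br b (u j - a).
    rewrite !(bilinBr brr) opprB [br b (u j)](alternating_opp brl brr brxx).
    rewrite opprK [br b a + _]addrC addrA subrK.
    by rewrite [br b a](alternating_opp brl brr brxx).
  by apply: (subspaceB hl); apply: lcs_br.
by have [h Hh /hc/eqP] := Hlcs c x; rewrite subr_eq0 => /eqP->.
Qed.

Lemma breadth_ge0 x (n : int) : n <= 0 -> breadth_ge br x n.
Proof. by exists 0%N; split=> //; exists (fun=> 0) => c _ []. Qed.

Lemma breadth_geW x (m n : int) :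
  m <= n -> breadth_ge br x n -> breadth_ge br x m.
Proof. by move=> mn [N [nN hN]]; exists N; split=> //; apply: le_trans nN. Qed.

Lemma br_sum x N (v : 'I_N -> L) (c : 'I_N -> F) :
  br x (\sum_i c i *: v i) = \sum_i c i *: br x (v i).
Proof.
elim/big_rec2: _ => [|i y1 y2 _ <-]; first exact: (bilin0r brr).
exact: brr.
Qed.

Lemma subspace0 : subspace (fun z : L => z = 0).
Proof. by split=> // c u v -> ->; rewrite scaler0 addr0. Qed.

(* A maximal family independent modulo the centralizer maps to a spanning list. *)
Lemma rank_le_of_breadth x (m : nat) :
  ~ breadth_ge br x m.+1%:Z -> rank_le br (fun z => z = 0) x m.
Proof.
move=> nb; apply: contrapT => nrk; apply: nb; exists m.+1; split=> //.
suff h N : (N <= m.+1)%N ->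
    exists v : 'I_N -> L, lin_indep_mod (centralizer br x) v by exact: h.
elim: N => [_|N IHN ltNm]; first by exists (fun=> 0) => c _ [].
have [v hv] := IHN (ltnW ltNm).
pose s := [seq br x (v i) | i <- enum 'I_N].
have hs := subspace_addspan s subspace0.
have [u nu] : exists u, ~ addspan (fun z => z = 0) s (br x u).
  apply: contrapT => nu; apply: nrk; exists s.
    by rewrite size_map -cardE card_ord.
  by move=> u; apply: contrapT => nsu; apply: nu; exists u.
exists (fun i => oapp v u (unlift ord0 i)) => c.
rewrite /centralizer big_ord_recl unlift_none /= brr.
under eq_bigr => j _ do rewrite liftK /=.
have [c0|c0] := eqVneq (c ord0) 0.
  rewrite c0 scale0r add0r => hc i.
  case: (unliftP ord0 i) => [j ->|-> //].
  exact: (hv (fun j => c (lift ord0 j))).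
move=> /eqP; rewrite addr_eq0 => /eqP hc; case: nu.
rewrite -[br x u](scalerK c0) hc br_sum.
apply: (subspaceZ _ hs); apply: (subspaceN hs).
apply: (subspace_sum _ hs) => j; apply: (subspaceZ _ hs).
by apply: (mem_addspan subspace0); apply: map_f; rewrite mem_enum.
Qed.

End NilpotentLieAlgebras.

(** * The bound on the derived algebra *)

Theorem theorem5p1 (F : finFieldType) (L : lmodType F) (br : L -> L -> L)
  (Hlie : lie_algebra br) (Hnil : nilpotent br)
  (n k : int) (Hnk : n <= k + 1)
  (H : F -> (L -> Prop)) (HHp : forall a : F, proper_subalgebra br (H a))
  (Hcov : forall x : L, breadth_ge br x n -> exists a : F, H a x)
  (Hgen : generates br (fun x => breadth_le br x k)) :
  dim_le (derived br) (divz ((n - 1) * (n - 2)) 2 + k).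
Proof.
case: (Hlie) => brl brr brxx _.
pose H' a := add_derived br (H a).
have hH' a : proper_subspace (H' a) by exact: proper_add_derived.
have H'out x : (forall a, ~ H' a x) -> ~ breadth_ge br x n.
  move=> nHx /Hcov[a Hax]; apply: (nHx a); exists x; rewrite ?subrr //.
  by case: (subspace_lcs Hlie 1).
have [|i _|y Hy] := not_covered (M := H') (s := enum F); rewrite -?cardE //.
have {}Hy a : ~ H' a y by apply: Hy; rewrite mem_enum.
(* Every breadth is at least 0, while [y] has breadth below [n]. *)
have n_gt0 : 0 < n.
  by rewrite ltNge; apply/negP => /(breadth_ge0 br y); apply: H'out.
case: n n_gt0 => // -[//|m] _ in Hnk Hcov H'out *.
have mk' : m%:Z <= k.
  by rewrite -(lerD2r 1) (le_trans _ Hnk) // -addn1.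
case: k mk' => // k mk in Hnk Hgen *.
have rkH' x : (forall a, ~ H' a x) -> rank_le br (fun z => z = 0) x m.
  by move=> /H'out; apply: rank_le_of_breadth.
(* Otherwise [K] contains every element of breadth at most [k], hence all [z] off the [H' a].
   Translating [y] by [L'] stays off them, so [K] contains [L'] and is a subalgebra, against
   generation. *)
have spanning K : proper_subspace K ->
    exists2 a, ~ K a & rank_le br (fun z => z = 0) a k.
  move=> [hK [x nKx]]; apply: contrapT => nK.
  have KA z : breadth_le br z k -> K z.
    move=> bz; apply: contrapT => nKz; apply: nK; exists z => //.
    by apply: rank_le_of_breadth => // hz; apply: bz; rewrite -PoszD addn1.
  have KH z : (forall a, ~ H' a z) -> K z.
    by move=> /H'out bz; apply: KA => hz; apply: bz; apply: breadth_geW hz.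
  have Kder z : derived br z -> K z.
    move=> dz; apply: (subspace_addl hK (KH y Hy)); apply: KH => a.
    by move/(add_derived_addr Hlie dz)/Hy.
  apply: nKx; apply: (Hgen K) => //; split.
  - by case: hK.
  - by move=> u v; apply: subspaceD.
  - by move=> c u; apply: subspaceZ.
  - by move=> u v _ _; apply: Kder; apply: lcs_br.
have [s sb hs] := image_dim_le_covering brl brr brxx (subspace0 L) hH' rkH' mk spanning.
have -> : divz ((m.+1%:Z - 1) * (m.+1%:Z - 2)) 2 + k%:Z = ('C(m, 2) + k)%N%:Z.
  rewrite PoszD bin2; congr (_ + _).
  (* For [m = 0] the factor [n - 2] is negative, but the product vanishes. *)
  case: m {mk Hnk Hcov H'out rkH' sb} => [|m] //.
  have -> : m.+2%:Z - 1 = m.+1 by rewrite -[m.+2]addn1 PoszD addrK.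
  have -> : m.+2%:Z - 2 = m by rewrite -[m.+2]addn2 PoszD addrK.
  by rewrite -PoszM divz_nat divn2.
move=> N ltN [v [dv indv]]; move: ltN; apply/negP; rewrite -leNgt lez_nat.
apply: leq_trans sb; apply: (indep_leq_addspan (subspace0 L) indv) => i.
have hs' := subspace_addspan s (subspace0 L).
have [M [u [w [_ ->]]]] := dv i.
by apply: (subspace_sum _ hs') => j.
Qed.
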